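(* Let $G_*$ be a central filtration on a group $G$. Then $\mathcal A_j(G_* )\subseteq\mathcal A_j(\sqrt{G_*})$ for all $j\ge0$.
   Context: A filtration $G_*$ on a group $G$ is a sequence of subgroups $G=G_1\supseteq G_2\supseteq\cdots$; it is central if $[G,G_i]\subseteq G_{i+1}$ for all $i\ge1$. For a filtration $G_*$ by normal subgroups, $\mathcal A_0(G_* )$ is the group of automorphisms $\varphi$ of $G$ such that $\varphi(G_i)\subseteq G_i$ and $\varphi^{-1}(G_i)\subseteq G_i$ for all $i$; for $j\ge1$, $\mathcal A_j(G_* )$ is the subgroup of those $\varphi\in\mathcal A_0(G_* )$ such that $\varphi(g)g^{-1}\in G_{i+j}$ for all $i\ge1$ and $g\in G_i$. $\sqrt{G_*}$ is the filtration of $G$ by the isolators $\sqrt{G_i}=\{g\in G\mid g^m\in G_i\text{ for some integer }m\ge1\}$, which for $G_*$ central are normal subgroups of $G$ and form the smallest torsion-free central filtration containing $G_*$. *)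

(* Defs.v *)
From HB Require Import structures.
From mathcomp Require Import all_boot.
From mathcomp Require Import boolp classical_sets.

Set Implicit Arguments.
Unset Strict Implicit.
Unset Printing Implicit Defensive.

Local Open Scope classical_set_scope.
Local Open Scope group_scope.

Definition is_subgroup (G : groupType) (H : set G) : Prop :=
  group_closed [in H].

Lemma is_subgroupP (G : groupType) (H : set G) :
  is_subgroup H <->
  [/\ H 1, forall x y, H x -> H y -> H (x * y) & forall x, H x -> H x^-1].
Proof.
split=> [sH|[H1 HM HV]].
  split=> [|x y /mem_set Hx /mem_set Hy|x /mem_set Hx].
  - exact/set_mem/(proj1 sH).
  - exact/set_mem/(group_closedM sH).
  - exact/set_mem/(group_closedV sH).
by split=> [|x y /set_mem Hx /set_mem Hy]; apply/mem_set => //; exact/HM/HV.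
Qed.

Definition generated (G : groupType) (A : set G) : set G :=
  smallest (@is_subgroup G) A.

(* [~ x, y] is x^-1 * y^-1 * x * y; for subgroups A and B, the other usual
   convention x * y * x^-1 * y^-1 has the same set of values. *)
Definition commutator (G : groupType) (A B : set G) : set G :=
  generated [set [~ x, y] | x in A & y in B].

(* Filtrations are indexed from 1: the value of a sequence at 0 is
   irrelevant, and no condition below mentions it. *)
Definition is_filtration (G : groupType) (F : nat -> set G) : Prop :=
  [/\ F 1%N = setT,
      forall i, (1 <= i)%N -> is_subgroup (F i) &
      forall i, (1 <= i)%N -> F i.+1 `<=` F i].

Definition is_central_filtration (G : groupType) (F : nat -> set G) : Prop :=
  is_filtration F /\
  forall i, (1 <= i)%N -> commutator setT (F i) `<=` F i.+1.

Definition isolator (G : groupType) (H : set G) : set G :=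
  [set g | exists2 m : nat, (1 <= m)%N & H (g ^+ m)].

Definition sqrt_filtration (G : groupType) (F : nat -> set G) : nat -> set G :=
  fun i => isolator (F i).

Definition filtration_aut0 (G : groupType) (F : nat -> set G) :
    set {multiplicative G -> G} :=
  [set phi | bijective phi /\
    forall i, (1 <= i)%N -> phi @` F i `<=` F i /\ phi @^-1` F i `<=` F i].

Definition filtration_aut (G : groupType) (F : nat -> set G) (j : nat) :
    set {multiplicative G -> G} :=
  if j is 0 then filtration_aut0 F else
  [set phi | filtration_aut0 F phi /\
    forall i, (1 <= i)%N -> forall g, F i g -> F (i + j)%N (phi g * g^-1)].

(* Main.v *)
Require Import Defs.
From HB Require Import structures.
From mathcomp Require Import all_boot.
From mathcomp Require Import boolp classical_sets.

(** A root of an element of F i is sent by a homomorphism preserving F i to a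
    root of an element of F i, which settles j = 0.  For j >= 1 and i >= 1, let
    N be the term F (i + j) of the filtration.  An automorphism phi in the j-th
    group moves each element of F i only by a factor in N, so if g ^+ m
    lies in F i then phi g and g have the same m-th power modulo N.  Since
    G / N is nilpotent, the theorem amounts to two classical facts on a
    nilpotent group: its torsion elements form a subgroup, and two elements
    with the same m-th power differ by a torsion element.  In terms of N,
    torsion modulo N is membership in the isolator of N.

    [isolator_in_nilpotent] proves both facts at once, by induction on the
    nilpotency class and without forming quotient groups.  The induction runs
    over the subgroups K lying above F l whose commutators lie in F l, where
    l + d is the index of N.  The idea is that for x in K the subgroup
    generated by x and F l has smaller class, because F l is central modulo
    F l.+1, and is normal in K.
    - Torsion: if x and y are torsion, let T be the torsion subgroup of the
      smaller group attached to y.  It is normal in K, and x * y is congruent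
      to x modulo T; so a power of x * y falls in T.
    - Roots: if x and y have the same m-th power, then so have x and x ^ y,
      which lie in the smaller group attached to x.  Hence [~ x, y] is
      torsion, so x and y commute modulo torsion, and the m-th power of
      x^-1 * y is torsion.

    In place of the subgroup generated by x and F l, the proof uses the double
    centraliser of x in K modulo F l.+1 ([double_centraliser]).  It has the
    three properties that matter -- it contains x and F l, and is abelian
    modulo F l.+1 -- and they follow without describing its elements as
    products. *)

Set Implicit Arguments.
Unset Strict Implicit.
Unset Printing Implicit Defensive.

Local Open Scope classical_set_scope.
Local Open Scope group_scope.

(** * Congruences modulo a normalised subgroup *)

Definition normalises (G : groupType) (K N : set G) : Prop :=
  forall g h, K g -> N h -> N (h ^ g).

Definition congruent (G : groupType) (N : set G) (x y : G) : Prop :=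
  N (x^-1 * y).

Definition centraliser_mod (G : groupType) (K N A : set G) : set G :=
  [set g | K g /\ forall a, A a -> N [~ g, a]].

Definition double_centraliser (G : groupType) (K N : set G) (x : G) : set G :=
  centraliser_mod K N (centraliser_mod K N [set x]).

Lemma subgroup_expg (G : groupType) (K : set G) x n :
  is_subgroup K -> K x -> K (x ^+ n).
Proof.
move=> /is_subgroupP [K1 KM _] Kx.
by elim: n => [|n IHn]; rewrite ?expg0 // expgS; exact: KM.
Qed.

Lemma multiplicative_expg (G H : groupType) (f : {multiplicative G -> H}) x n :
  f (x ^+ n) = f x ^+ n.
Proof.
have f1 : f 1 = 1 by apply: (mulgI (f 1)); rewrite -gmulfM !mulg1.
by elim: n => [|n IHn]; rewrite ?expg0 // !expgS gmulfM IHn.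
Qed.

Lemma commMg (G : groupType) (x y z : G) :
  [~ x * y, z] = [~ x, z] ^ y * [~ y, z].
Proof. by rewrite /commg /conjg !gnorm. Qed.

Lemma commgM (G : groupType) (x y z : G) :
  [~ x, y * z] = [~ x, z] * [~ x, y] ^ z.
Proof. by rewrite /commg /conjg !gnorm. Qed.

Lemma commVg (G : groupType) (x y : G) : [~ x^-1, y] = ([~ x, y]^-1) ^ x^-1.
Proof. by rewrite /commg /conjg !gnorm. Qed.

Section Congruence.

Context {G : groupType} {K N : set G}.
Hypotheses (sK : is_subgroup K) (sN : is_subgroup N) (nKN : normalises K N).

Let N1 : N 1. Proof. by have [] := proj1 (is_subgroupP N) sN. Qed.
Let NM x y : N x -> N y -> N (x * y).
Proof. by have [_ h _] := proj1 (is_subgroupP N) sN; exact: h. Qed.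
Let NV x : N x -> N x^-1.
Proof. by have [_ _ h] := proj1 (is_subgroupP N) sN; exact: h. Qed.
Let KM x y : K x -> K y -> K (x * y).
Proof. by have [_ h _] := proj1 (is_subgroupP K) sK; exact: h. Qed.
Let KV x : K x -> K x^-1.
Proof. by have [_ _ h] := proj1 (is_subgroupP K) sK; exact: h. Qed.

Lemma congruent_refl x : congruent N x x.
Proof. by rewrite /congruent mulVg. Qed.

Lemma congruent_sym x y : congruent N x y -> congruent N y x.
Proof. by move/NV; rewrite /congruent invgM invgK. Qed.

Lemma congruent_trans y x z :
  congruent N x y -> congruent N y z -> congruent N x z.
Proof.
move=> xy yz; rewrite /congruent.
have -> : x^-1 * z = (x^-1 * y) * (y^-1 * z) by rewrite !gnorm.
exact: NM.
Qed.

Lemma congruent_mul x x' y y' : K y ->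
  congruent N x x' -> congruent N y y' -> congruent N (x * y) (x' * y').
Proof.
move=> Ky xx' yy'; rewrite /congruent.
have -> : (x * y)^-1 * (x' * y') = (x^-1 * x') ^ y * (y^-1 * y').
  by rewrite /conjg !gnorm.
exact: NM (nKN Ky xx') yy'.
Qed.

Lemma congruent_expg x y n : K x ->
  congruent N x y -> congruent N (x ^+ n) (y ^+ n).
Proof.
move=> Kx xy; elim: n => [|n IHn]; first exact: congruent_refl.
by rewrite !expgSr; exact: congruent_mul.
Qed.

Lemma congruent_mem x y : congruent N x y -> N y -> N x.
Proof.
move=> xy Ny; have -> : x = y * (x^-1 * y)^-1 by rewrite !gnorm.
exact: NM Ny (NV xy).
Qed.

Lemma commg_expr x y n : K y -> N [~ x, y] -> N [~ x, y ^+ n].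
Proof.
move=> Ky xy; elim: n => [|n IHn]; first by rewrite expg0 commg1.
by rewrite expgSr commgM; apply: NM => //; exact: nKN.
Qed.

Lemma congruent_expgM x y n : K x -> K y -> N [~ x, y] ->
  congruent N ((x * y) ^+ n) (x ^+ n * y ^+ n).
Proof.
move=> Kx Ky xy; elim: n => [|n IHn].
  by rewrite !expg0 mulg1; exact: congruent_refl.
rewrite expgSr; apply: (@congruent_trans (x ^+ n * y ^+ n * (x * y))).
  by apply: congruent_mul IHn (congruent_refl _); exact: KM.
rewrite (expgSr x) (expgSr y) !mulgA.
apply: (congruent_mul Ky _ (congruent_refl _)).
have -> : congruent N (x ^+ n * y ^+ n * x) (x ^+ n * x * y ^+ n)
         = N [~ x, y ^+ n].
  by rewrite /congruent /commg /conjg !gnorm.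
exact: commg_expr.
Qed.

Lemma commgV_mem x y : K x -> N [~ x, y] -> N [~ x^-1, y].
Proof.
by move=> Kx xy; rewrite commVg; apply: nKN; [exact: KV | exact: NV].
Qed.

Lemma centraliser_mod_subgroup (A : set G) :
  is_subgroup (centraliser_mod K N A).
Proof.
apply/is_subgroupP; split=> [|x y [Kx xA] [Ky yA]|x [Kx xA]].
- split; first by have [] := proj1 (is_subgroupP K) sK.
  by move=> a _; rewrite comm1g.
- split=> [|a Aa]; first exact: KM.
  by rewrite commMg; apply: NM (yA a Aa); exact: nKN (xA a Aa).
- by split=> [|a Aa]; [exact: KV | apply: commgV_mem => //; exact: xA].
Qed.

Lemma commg_sym x y : N [~ x, y] -> N [~ y, x].
Proof. by move/NV; rewrite invgR. Qed.

Lemma mem_double_centraliser x : K x -> double_centraliser K N x x.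
Proof. by move=> Kx; split=> // a [_ ax]; apply: commg_sym; exact: ax. Qed.

(** As x centralises itself, every z in the double centraliser commutes with
    x.  So z lies in the centraliser of x, with which y commutes by
    definition. *)
Lemma double_centraliser_abelian x y z : K x ->
  double_centraliser K N x y -> double_centraliser K N x z -> N [~ y, z].
Proof.
move=> Kx [_ yC] [Kz zC]; apply: yC; split=> // _ ->; apply: zC.
by split=> // _ ->; rewrite commgg.
Qed.

End Congruence.

(** * Isolators *)

Lemma isolator_sub (G : groupType) (N : set G) : N `<=` isolator N.
Proof. by move=> x Nx; exists 1%N; rewrite ?expg1. Qed.

Lemma isolator_root (G : groupType) (N : set G) x m :
  (1 <= m)%N -> isolator N (x ^+ m) -> isolator N x.
Proof.
move=> m1 [k k1 h]; exists (m * k)%N; first by rewrite muln_gt0 m1.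
by rewrite expgnA.
Qed.

Lemma normalises_isolator (G : groupType) (K N : set G) :
  normalises K N -> normalises K (isolator N).
Proof.
by move=> nKN g h Kg [m m1 Nh]; exists m; rewrite // -conjXg; exact: nKN.
Qed.

Lemma isolator_inv (G : groupType) (N : set G) x :
  is_subgroup N -> isolator N x -> isolator N x^-1.
Proof.
move=> /is_subgroupP[_ _ NV] [m m1 Nx].
by exists m; rewrite // expVgn; exact: NV.
Qed.

(** The m-th power of x^-1 * y is congruent to x ^- m * y ^+ m modulo T.
    Commutation is only asked modulo a subgroup T of the isolator,
    because in the induction below the commutator of x and y is first known
    to be torsion, not to lie in N. *)
Lemma isolator_commuting_roots (G : groupType) (K N T : set G) x y m :
    is_subgroup K -> is_subgroup T -> normalises K T ->
    T `<=` isolator N -> K x -> K y -> T [~ x, y] -> (1 <= m)%N ->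
    T (x ^- m * y ^+ m) ->
  isolator N (x^-1 * y).
Proof.
move=> sK sT nKT TN Kx Ky xy m1 Tm; apply: (isolator_root m1); apply: TN.
have [_ _ KV] := proj1 (is_subgroupP K) sK.
have := congruent_expgM sK sT nKT m (KV _ Kx) Ky (commgV_mem sK sT nKT Kx xy).
by rewrite expVgn => /(congruent_mem sT); exact.
Qed.

(** * Torsion in nilpotent groups *)

Section CentralFiltration.

Context {G : groupType} {F : nat -> set G}.
Hypothesis hF : is_central_filtration F.

Lemma filtration_subgroup i : (1 <= i)%N -> is_subgroup (F i).
Proof. by case: hF => [[_ h _] _]; exact: h. Qed.

Lemma filtration_le i d g : (1 <= i)%N -> F (i + d) g -> F i g.
Proof.
move=> i1; elim: d => [|d IHd]; first by rewrite addn0.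
case: hF => [[_ _ h] _]; rewrite addnS => Fg.
by apply: IHd; apply: h Fg; rewrite ltn_addr.
Qed.

Lemma filtration_central i g h : (1 <= i)%N -> F i h -> F i.+1 [~ g, h].
Proof.
move=> i1 Fh; case: hF => _ /(_ i i1); apply.
by move=> A [_]; apply; exists g => //; exists h.
Qed.

Lemma filtration_normal (K : set G) i : (1 <= i)%N -> normalises K (F i).
Proof.
move=> i1 g h _ Fh.
have -> : h ^ g = h * [~ g, h]^-1 by rewrite /commg /conjg !gnorm.
have [_ FM FV] := proj1 (is_subgroupP _) (filtration_subgroup i1).
apply: FM => //; apply: FV; apply: (@filtration_le _ 1%N) => //.
by rewrite addn1; exact: filtration_central.
Qed.

(** The two conclusions are proved together because the second needs the
    torsion elements to form a subgroup.  The hypotheses on K are those that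
    pass to the double centralisers, with l.+1 in place of l; d counts the
    steps left until F l is N, where K is abelian modulo N. *)
Theorem isolator_in_nilpotent (d l : nat) (K : set G) (N := F (l + d)) :
    (1 <= l)%N -> is_subgroup K -> F l `<=` K ->
    (forall x y, K x -> K y -> F l [~ x, y]) ->
  is_subgroup (K `&` isolator N) /\
  forall x y m, K x -> K y -> (1 <= m)%N -> N (x ^- m * y ^+ m) ->
    isolator N (x^-1 * y).
Proof.
elim: d l K @N => [|d IHd] l K N l1 sK FK KF.
  have sN : is_subgroup N by apply: filtration_subgroup; rewrite addn0.
  have nKN : normalises K N by apply: filtration_normal; rewrite addn0.
  have KN x y : K x -> K y -> N [~ x, y] by rewrite /N addn0; exact: KF.
  have [K1 KM KV] := proj1 (is_subgroupP K) sK.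
  have [N1 NM NV] := proj1 (is_subgroupP N) sN.
  split; last first.
    move=> x y m Kx Ky m1; apply: (isolator_commuting_roots sK sN nKN) => //.
      exact: isolator_sub.
    exact: KN.
  apply/is_subgroupP; split=> [|x y [Kx [a a1 Na]] [Ky [b b1 Nb]]|x [Kx Ix]].
  - by split=> //; exact: isolator_sub.
  - split; first exact: KM.
    exists (a * b)%N; first by rewrite muln_gt0 a1.
    have xy := KN _ _ Kx Ky.
    apply: (congruent_mem sN (congruent_expgM sK sN nKN _ Kx Ky xy)).
    by apply: NM; [rewrite expgnA | rewrite mulnC expgnA]; exact: subgroup_expg.
  - by split; [exact: KV | exact: isolator_inv].
have [K1 KM KV] := proj1 (is_subgroupP K) sK.
have n1 : (1 <= l + d.+1)%N by rewrite addnS.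
have sN : is_subgroup N := filtration_subgroup n1.
have nKN : normalises K N := filtration_normal n1.
have nKF : normalises K (F l.+1) by exact: filtration_normal.
have sF : is_subgroup (F l.+1) by exact: filtration_subgroup.
pose D x := double_centraliser K (F l.+1) x.
have sD x : is_subgroup (D x) by exact: centraliser_mod_subgroup.
have DK x : D x `<=` K by move=> g [].
have FD x : F l `<=` D x.
  move=> g Fg; split=> [|a _]; first exact: FK.
  by apply: (commg_sym sF); exact: filtration_central.
have ND x : N `<=` D x by move=> g /(filtration_le l1); exact: FD.
have nKD x : normalises K (D x).
  move=> g h Kg Dh; have [_ DM _] := proj1 (is_subgroupP _) (sD x).
  have -> : h ^ g = h * [~ h, g] by rewrite /commg /conjg !gnorm.
  by apply: DM => //; apply: FD; apply: KF => //; exact: DK Dh.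
(* D x has smaller class, so the induction hypothesis applies to it. *)
have IHD x : K x -> is_subgroup (D x `&` isolator N) /\
    forall u v m, D x u -> D x v -> (1 <= m)%N -> N (u ^- m * v ^+ m) ->
      isolator N (u^-1 * v).
  move=> Kx; rewrite /N -addSnnS; apply: IHd => //.
    move=> g Fg; apply: FD.
    by apply: (@filtration_le _ 1%N) => //; rewrite addn1.
  by move=> y z; exact: (double_centraliser_abelian sF Kx).
have sT : is_subgroup (K `&` isolator N).
  apply/is_subgroupP; split=> [|x y [Kx [m m1 Nx]] [Ky Iy]|x [Kx Ix]].
  - split=> //; apply: isolator_sub.
    by have [] := proj1 (is_subgroupP N) sN.
  - split; first exact: KM.
    have [sS _] := IHD _ Ky.
    have nKS : normalises K (D y `&` isolator N).
      move=> g h Kg [Dh Ih]; split; first exact: nKD.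
      exact: (normalises_isolator nKN Kg Ih).
    have xyx : congruent (D y `&` isolator N) (x * y) x.
      rewrite /congruent; have -> : (x * y)^-1 * x = y^-1 by rewrite !gnorm.
      have [_ _ SV] := proj1 (is_subgroupP _) sS; apply: SV.
      by split=> //; exact: (mem_double_centraliser sF Ky).
    have := congruent_expg sS nKS m (KM _ _ Kx Ky) xyx.
    move=> /(congruent_mem sS) h; apply: (isolator_root m1).
    by case: h => //; split; [exact: ND | exact: isolator_sub].
  - by split; [exact: KV | exact: isolator_inv].
split=> // x y m Kx Ky m1 Nm.
have nKT : normalises K (K `&` isolator N).
  move=> g h Kg [Kh Ih]; split; last exact: (normalises_isolator nKN Kg Ih).
  by rewrite /conjg; exact: KM (KV _ Kg) (KM _ _ Kh Kg).
apply: (isolator_commuting_roots sK sT nKT _ Kx Ky _ m1).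
- by move=> g [].
- have [_ roots] := IHD _ Kx.
  split; first by apply: FK; exact: KF.
  have Dx : D x x by exact: (mem_double_centraliser sF Kx).
  rewrite commgEl; apply: (roots _ _ m) => //; first exact: nKD.
  (* Conjugation by y fixes y ^+ m, which is congruent to x ^+ m. *)
  rewrite -conjXg; apply: (congruent_trans sN Nm).
  have -> : congruent N (y ^+ m) (x ^+ m ^ y) = N ((y ^- m * x ^+ m) ^ y).
    by rewrite conjMg conjVg (conjXg y y) [y ^ y]/conjg mulKg.
  by apply: nKN => //; exact: (congruent_sym sN Nm).
split; last exact: isolator_sub.
by apply: (DK x); exact: ND.
Qed.

Corollary isolator_of_eq_expg n x y m : (1 <= n)%N -> (1 <= m)%N ->
  F n (x ^+ m * y ^- m) -> isolator (F n) (x * y^-1).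
Proof.
move=> n1 m1 Fxy; have F1 : F 1%N = setT by case: hF => [[]].
have [||||_ roots] := @isolator_in_nilpotent n.-1 1%N setT.
- by [].
- by apply/is_subgroupP.
- by [].
- by move=> x' y' _ _; rewrite F1.
rewrite add1n prednK // in roots.
rewrite -[x in x * _]invgK; apply: (roots _ _ m) => //.
by rewrite !expVgn invgK.
Qed.

Lemma sqrt_filtration_aut0 phi :
  filtration_aut0 F phi -> filtration_aut0 (sqrt_filtration F) phi.
Proof.
move=> [bij stable]; split=> // i i1; have [im preim] := stable i i1.
split=> [_ [g [m m1 Fg] <-]|g [m m1 Fg]]; exists m => //.
  by rewrite -multiplicative_expg; apply: im; exists (g ^+ m).
by apply: preim; rewrite /= multiplicative_expg.
Qed.

End CentralFiltration.

Theorem proposition3p9 (G : groupType) (F : nat -> set G)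
    (hF : is_central_filtration F) (j : nat) :
  filtration_aut F j `<=` filtration_aut (sqrt_filtration F) j.
Proof.
case: j => [|j] phi; first exact: sqrt_filtration_aut0.
move=> [aut0 close]; split; first exact: sqrt_filtration_aut0.
move=> i i1 g [m m1 Fg]; apply: (isolator_of_eq_expg hF _ m1).
  by rewrite addnS.
by rewrite -multiplicative_expg; exact: close.
Qed.
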